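(* Let $\beta\ge 0$. For each $N$ let $N_1=N_1(N)$ and $N_2=N_2(N)$ be positive integers with $N_1+N_2\le N$, and let $X_1,\dots,X_{N_1}$ and $Y_1,\dots,Y_{N_2}$ be two disjoint groups of spins chosen out of the $N$ spins of the Curie-Weiss model with $N$ spins at inverse temperature $\beta$. If $N_1\to\infty$ and $N_2\to\infty$ as $N\to\infty$, then the two-dimensional random vectors $$\Big(\frac{1}{N_1}\sum_{i=1}^{N_1}X_i,\ \frac{1}{N_2}\sum_{j=1}^{N_2}Y_j\Big)$$ converge in distribution, as $N\to\infty$, to the probability measure $$\frac12\big(\delta_{(-m(\beta),-m(\beta))}+\delta_{(m(\beta),m(\beta))}\big)$$ on $\mathbb{R}^2$.
   Context: The Curie-Weiss model with $N$ spins at inverse temperature $\beta\ge 0$ is the probability measure on $\{-1,1\}^N$ given by $\mathbb{P}(x_1,\dots,x_N)=Z^{-1}\exp\big(\frac{\beta}{2N}(\sum_{j=1}^N x_j)^2\big)$, where $Z=Z(N,\beta)$ is the normalizing constant; the spins are the coordinate random variables. The number $m(\beta)$ is defined as follows: if $\beta\le 1$, then $m(\beta)=0$ (the unique real solution of $\tanh(\beta x)=x$); if $\beta>1$, then $m(\beta)$ is the unique positive solution of $\tanh(\beta x)=x$. $\delta_x$ denotes the Dirac measure at $x$. *)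

(* Defs.v *)
From HB Require Import structures.
From mathcomp Require Import all_boot all_order all_algebra.
From mathcomp Require Import all_classical all_reals all_analysis.

Set Implicit Arguments.
Unset Strict Implicit.
Unset Printing Implicit Defensive.

Import Order.TTheory GRing.Theory Num.Theory.
Import numFieldNormedType.Exports.

Local Open Scope classical_set_scope.
Local Open Scope ring_scope.

(* {-1,1}^N is encoded as {ffun 'I_N -> bool}, with true standing for the spin
   value 1 and false for -1 (see [spin]); it carries the discrete
   sigma-algebra. *)
Definition config (N : nat) : Type := {ffun 'I_N -> bool}.

HB.instance Definition _ (N : nat) := Finite.on (config N).
HB.instance Definition _ (N : nat) :=
  isPointed.Build (config N) [ffun=> true].
HB.instance Definition _ (N : nat) :=
  @isMeasurable.Build default_measure_display (config N) discrete_measurable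
    discrete_measurable0 discrete_measurableC discrete_measurableU.

Definition spin (R : realType) (N : nat) (j : 'I_N) (x : config N) : R :=
  if x j then 1 else -1.

Section curie_weiss.
Context (R : realType) (beta : R) (N : nat).

Definition cw_weight (x : config N) : R :=
  expR (beta / (2 * N%:R) * (\sum_(j < N) spin R j x) ^+ 2).

Definition cw_Z : R := \sum_(x : config N) cw_weight x.

Definition cw_pmf (x : config N) : R := cw_Z^-1 * cw_weight x.

Definition curie_weiss (A : set (config N)) : \bar R :=
  (\sum_(x : config N | x \in A) cw_pmf x)%:E.

Lemma cw_Z_gt0 : 0 < cw_Z.
Proof.
rewrite /cw_Z (bigD1 ([ffun=> true] : config N)) //=.
by apply: ltr_pwDl; [exact: expR_gt0 | apply: sumr_ge0 => x _; exact: expR_ge0].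
Qed.

Lemma cw_pmf_ge0 x : 0 <= cw_pmf x.
Proof. by rewrite mulr_ge0 ?expR_ge0 // invr_ge0 ltW // cw_Z_gt0. Qed.

Let curie_weiss_dirac A :
  curie_weiss A = (\sum_(x : config N) (cw_pmf x)%:E * \d_x A)%E.
Proof.
rewrite /curie_weiss big_mkcond -sumEFin; apply: eq_bigr => x _.
by rewrite diracE; case: (x \in A); rewrite ?mule1 ?mule0.
Qed.

Let curie_weiss0 : curie_weiss set0 = 0%E.
Proof. by rewrite /curie_weiss big_pred0 // => x; rewrite in_set0. Qed.

Let curie_weiss_ge0 A : (0 <= curie_weiss A)%E.
Proof. by rewrite lee_fin sumr_ge0 // => x _; exact: cw_pmf_ge0. Qed.

Let curie_weiss_sigma_additive : semi_sigma_additive curie_weiss.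
Proof.
move=> F mF tF mUF.
pose x_ k : config N := nth [ffun=> true] (enum {: config N}) k.
pose m (k : nat) : {measure set (config N) -> \bar R} :=
  mscale (NngNum (cw_pmf_ge0 (x_ k))) (\d_(x_ k)).
have E A : curie_weiss A = msum m (size (enum {: config N})) A.
  rewrite curie_weiss_dirac /msum -big_enum /=.
  by rewrite (big_nth [ffun=> true]) big_mkord.
rewrite E; under eq_fun do under eq_bigr do rewrite E.
exact: measure_semi_sigma_additive.
Qed.

HB.instance Definition _ := isMeasure.Build _ _ _ curie_weiss
  curie_weiss0 curie_weiss_ge0 curie_weiss_sigma_additive.

Let curie_weiss_setT : curie_weiss setT = 1%E.
Proof.
rewrite /curie_weiss (eq_bigl xpredT) => [|x]; last by rewrite in_setT.
by rewrite -big_distrr /= -/cw_Z mulVf // gt_eqF // cw_Z_gt0.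
Qed.

HB.instance Definition _ :=
  @Measure_isProbability.Build _ _ R curie_weiss curie_weiss_setT.

End curie_weiss.
Arguments curie_weiss {R} beta N A.

Section spin_averages.
Context (R : realType) (N : nat).

Definition spin_average (A : {set 'I_N}) (x : config N) : R :=
  #|A|%:R^-1 * \sum_(i in A) spin R i x.

Definition spin_averages (A B : {set 'I_N}) (x : config N) : R * R :=
  (spin_average A x, spin_average B x).

Let measurable_spin_averages (A B : {set 'I_N}) :
  measurable_fun setT (spin_averages A B).
Proof. by []. Qed.

HB.instance Definition _ (A B : {set 'I_N}) :=
  isMeasurableFun.Build _ _ _ _ (spin_averages A B)
    (@measurable_spin_averages A B).

End spin_averages.

(* The product sigma-algebra on R * R is the Borel sigma-algebra. *)
Definition weak_cvg (R : realType)
    (mu_ : nat -> probability (R * R)%type R)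
    (mu : probability (R * R)%type R) : Prop :=
  forall f : R * R -> R, continuous f ->
    (exists M : R, forall z, `|f z| <= M) ->
    (\int[mu_ n]_z (f z)%:E)%E @[n --> \oo] --> (\int[mu]_z (f z)%:E)%E.

Definition cvg_in_distribution (R : realType)
    (d : nat -> measure_display) (T : forall n, measurableType (d n))
    (P : forall n, probability (T n) R)
    (X : forall n, {RV (P n) >-> (R * R)%type})
    (mu : probability (R * R)%type R) : Prop :=
  weak_cvg (fun n => distribution (P n) (X n)) mu.

Definition tanh (R : realType) (x : R) : R :=
  (expR x - expR (- x)) / (expR x + expR (- x)).

(* [xget 0] selects the positive solution, which for 1 < beta exists and is
   unique; the default value 0 is then never used. *)
Definition magnetization (R : realType) (beta : R) : R :=
  if beta <= 1 then 0 else xget 0 [set x | 0 < x /\ tanh (beta * x) = x].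

Section half_dirac2.
Context (R : realType) (a b : R * R).

Definition half_dirac2 : set (R * R) -> \bar R :=
  mscale (2^-1)%:nng (measure_add (\d_a) (\d_b)).

HB.instance Definition _ := Measure.on half_dirac2.

Let half_dirac2_setT : half_dirac2 setT = 1%E.
Proof.
rewrite /half_dirac2 /mscale /= /msum !big_ord_recl big_ord0 /= adde0.
rewrite !diracT -EFinD -EFinM -[1 + 1]/(2 : R).
by rewrite mulVf.
Qed.

HB.instance Definition _ :=
  @Measure_isProbability.Build _ _ R half_dirac2 half_dirac2_setT.

End half_dirac2.

(* Main.v *)
(* Let M be the mean of all N spins. By exchangeability two distinct spins have
   a common correlation c, so the group averages satisfy
   E (avg_A - M)^2 = (1 - c) (1/|A| - 1/N) <= 2/|A|, and it is enough to study M.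
   The number k of up spins has weights q(k) = C(N, k) exp(beta (2k - N)^2 / 2N)
   with q(k+1)/q(k) close to (1 - y)/(1 + y) exp(2 beta y), y = (2k + 1 - N)/N,
   and this ratio exceeds 1 for 0 < y < m(beta) and is below 1 for y > m(beta).
   A level at distance eps from +- m(beta) is therefore dominated, after order N
   geometric steps towards m(beta), by another single level, so |M| tends to
   m(beta) in probability. The symmetry x |-> -x splits the mass evenly. *)
Require Import Defs.
From mathcomp Require Import all_boot all_order all_algebra.
From mathcomp Require Import all_classical all_reals all_analysis.
From mathcomp Require Import measurable_realfun perm.
From mathcomp Require Import ring lra zify.
Import Order.TTheory GRing.Theory Num.Theory.
Import numFieldNormedType.Exports.
Local Open Scope classical_set_scope.
Local Open Scope ring_scope.
Set Implicit Arguments.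
Unset Strict Implicit.
Unset Printing Implicit Defensive.

(** * Measurability on the plane and integrals against the measures involved *)

(** An open set is the countable union of the squares with rational centre and radius 1/(n+1) that
    it contains, and such squares are measurable rectangles. *)
Lemma open_measurable_prod (R : realType) (U : set (R * R)) :
  open U -> measurable U.
Proof.
move=> oU.
pose F (q1 q2 : rat) (n : nat) : set (R * R) :=
  let V := ball (ratr q1 : R) n.+1%:R^-1 `*` ball (ratr q2 : R) n.+1%:R^-1 in
  if asbool (V `<=` U) then V else set0.
have -> : U = \bigcup_q1 \bigcup_q2 \bigcup_n F q1 q2 n.
  apply/seteqP; split => [[x y] Uxy|[x y] [q1 _ [q2 _ [n _]]]]; last first.
    by rewrite /F; case: asboolP => // VU /VU.
  move: oU; rewrite openE => /(_ _ Uxy) /nbhs_ballP[e /= e0 eU].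
  have e20 : 0 < e / 2 by rewrite divr_gt0.
  near \oo => n.
  have ne : n.+1%:R^-1 < e / 2 :> R.
    by near: n; exact: (near_infty_natSinv_lt (PosNum e20)).
  have n0 : 0 < n.+1%:R^-1 :> R by rewrite invr_gt0.
  move: ne n0; move rE : (n.+1%:R^-1) => r ne n0.
  have [q1] : exists q : rat, ball x r (ratr q).
    have /rat_in_itvoo[q] : x - r < x + r by lra.
    rewrite in_itv /= => /andP[h1 h2].
    by exists q; rewrite /ball /= ltr_norml; apply/andP; split; lra.
  have [q2] : exists q : rat, ball y r (ratr q).
    have /rat_in_itvoo[q] : y - r < y + r by lra.
    rewrite in_itv /= => /andP[h1 h2].
    by exists q; rewrite /ball /= ltr_norml; apply/andP; split; lra.
  rewrite /ball /= !ltr_norml => /andP[b1 b2] /andP[c1 c2].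
  exists q1 => //; exists q2 => //; exists n => //; rewrite /F rE.
  case: asboolP => [_|[]].
    by split; rewrite /ball /= ltr_norml; apply/andP; split; lra.
  move=> [u v] [/= ]; rewrite /ball /= !ltr_norml => /andP[d1 d2] /andP[f1 f2].
  apply: eU; split; rewrite /ball /= ltr_norml; apply/andP; split; lra.
apply: bigcupT_measurable_rat => q1; apply: bigcupT_measurable_rat => q2.
apply: bigcupT_measurable => n; rewrite /F; case: asboolP => // _.
by apply: measurableX; rewrite ball_itv; exact: measurable_itv.
Unshelve. all: by end_near. Qed.

Lemma continuous_measurable_prod (R : realType) (f : R * R -> R) :
  continuous f -> measurable_fun setT f.
Proof.
move=> /continuousP cf; apply: (measurability _ (RGenOpens.measurableE R)).
move=> _ [_ [a [b ->] <-]]; rewrite setTI; apply: open_measurable_prod.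
exact/cf/interval_open.
Qed.

Lemma integral_half_dirac2 (R : realType) (a b : R * R) (f : R * R -> R) :
  measurable_fun setT f ->
  (\int[half_dirac2 a b]_z (f z)%:E)%E = ((f a + f b) / 2)%:E.
Proof.
move=> mf; have mf' : measurable_fun setT (EFin \o f) by exact/measurable_EFinP.
(* Additivity in the measure is used for nonnegative functions only; [f] is then split into its
   positive and negative parts. *)
have ge0E (g : R * R -> \bar R) : measurable_fun setT g -> (forall z, 0 <= g z)%E ->
    (\int[half_dirac2 a b]_z g z = 2^-1%:E * (g a + g b))%E.
  move=> mg g0; rewrite ge0_integral_mscale// ge0_integral_measure_add//.
  by rewrite !integral_dirac// !diracT !mul1e.
rewrite integralE !ge0E//; try exact: measurable_funepos; try exact: measurable_funeneg.
rewrite funerpos funerneg [LHS]/= -!(EFinD, EFinM, EFinN); congr EFin.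
by rewrite /funrpos /funrneg; do 4 case: ltP => ?; lra.
Qed.

(** Any function on the finite configuration space is a finite combination of indicators of
    singletons, so linearity of the integral suffices. *)
Lemma integral_curie_weiss (R : realType) (beta : R) (N : nat) (g : config N -> R) :
  (\int[curie_weiss beta N]_x (g x)%:E)%E = (\sum_x cw_pmf beta x * g x)%:E.
Proof.
have mT (f : config N -> \bar R) : measurable_fun setT f by [].
transitivity (\int[curie_weiss beta N]_x
    (\sum_(y : config N) (g y)%:E * (\1_[set y] x)%:E))%E.
  apply: eq_integral => x _; rewrite (bigD1 x) //= indicE mem_set// mule1.
  rewrite big1 ?adde0// => y yx; rewrite indicE memNset ?mule0//= => /esym/eqP.
  by rewrite (negPf yx).
have int1 y : (curie_weiss beta N).-integrable setT
    (fun x => (\1_[set y] x)%:E).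
  apply: measurable_bounded_integrable => //.
    by apply: le_lt_trans (probability_le1 _ _) _ => //; rewrite ltry.
  by exists 1; split=> // M M1 x _ /=; rewrite ger0_norm ?indicE//; case: (_ \in _) => /=; lra.
rewrite integral_sum//; last by move=> y; exact: integrableZl.
rewrite -sumEFin; apply: eq_bigr => y _.
rewrite integralZl// integral_indic// setIT mulrC EFinM; congr (_ * _)%E.
transitivity (\sum_(x : config N | x \in [set y]) cw_pmf beta x)%:E => //.
rewrite (eq_bigl (pred1 y)) ?big_pred1_eq// => x.
by apply/idP/eqP => [|->]; rewrite inE.
Qed.

(** * The sign of the drift on either side of the magnetization *)

Section drift.
Context (R : realType) (beta : R).
(* The logarithm of (1 - y)/(1 + y) exp(2 beta y); strictly concave on [0, 1). *)
Let l (y : R) := 2 * beta * y + ln (1 - y) - ln (1 + y).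
Let dl (y : R) : R := 2 * beta - 2 / (1 - y ^+ 2).

Let is_derive_l (y : R) : -1 < y < 1 -> is_derive y 1 l (dl y).
Proof.
move=> /andP[y1 y2].
have h1 : is_derive y 1 (@ln R \o (fun y => 1 - y)) ((1 - y)^-1 * -1).
  apply: is_derive1_comp; first by apply: is_derive1_ln; lra.
  by apply: is_derive_eq; rewrite add0r mul1r.
have h2 : is_derive y 1 (@ln R \o (fun y => 1 + y)) ((1 + y)^-1 * 1).
  apply: is_derive1_comp; first by apply: is_derive1_ln; lra.
  by apply: is_derive_eq; rewrite add0r mul1r.
have h3 : is_derive y 1 (fun y => 2 * beta * y) (2 * beta).
  by apply: is_derive_eq; rewrite /GRing.scale /= mulr1.
apply: (is_derive_eq (is_deriveB (is_deriveD h3 h1) h2)); rewrite /dl.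
by field; do ![apply/andP; split]; rewrite -?expr2; nra.
Qed.

Let l_within u v : -1 < u -> v < 1 -> {within `[u, v], continuous l}.
Proof.
move=> u1 v1; apply: derivable_within_continuous => x.
rewrite in_itv /= => /andP[h1 h2].
by apply: ex_derive; apply: is_derive_l; apply/andP; split; lra.
Qed.

Let l_slope a : 0 < a -> a < 1 -> exists2 c, 0 < c < a & l a = dl c * a.
Proof.
move=> a0 a1.
have [x||] := @MVT R l dl 0 a a0.
- rewrite in_itv /= => /andP[h1 h2].
  by apply: is_derive_l; apply/andP; split; lra.
- by apply: l_within; lra.
move=> c; rewrite in_itv /= => hc; rewrite (_ : l 0 = 0) ?subr0 => [lc|]; first by exists c.
by rewrite /l mulr0 subr0 addr0 ln1; ring.
Qed.

(** By concavity and [l 0 = 0], the quotient l(y)/y is strictly decreasing: the mean slope on [0, a]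
    exceeds the one on [a, b]. *)
Let l_lt a b : 0 < a -> a < b -> b < 1 -> a * l b < b * l a.
Proof.
move=> a0 ab b1.
have [c /andP[c0 ca] hc] := l_slope a0 (lt_trans ab b1).
have [||d] := @MVT R l dl a b ab.
- move=> x; rewrite in_itv /= => /andP[h1 h2].
  by apply: is_derive_l; apply/andP; split; lra.
- by apply: l_within; lra.
rewrite in_itv /= => /andP[ad db] hd.
have dcd : dl d < dl c.
  rewrite /dl ltrD2l ltrN2 ltr_pM2l// ltf_pV2 ?posrE; nra.
rewrite hc (_ : l b = dl c * a + dl d * (b - a)); last by rewrite -hc -hd; ring.
have : 0 < (dl c - dl d) * (a * (b - a)) by rewrite mulr_gt0 ?mulr_gt0; lra.
nra.
Qed.

Let expR_l y : -1 < y < 1 -> expR (l y) * (1 + y) = (1 - y) * expR (2 * beta * y).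
Proof.
move=> /andP[y1 y2]; rewrite /l !expRD expRN !lnK ?posrE; [|lra|lra].
by field; rewrite ?gt_eqF//; lra.
Qed.

Let l_gt0P y : -1 < y < 1 ->
  (0 < l y) = (1 + y < (1 - y) * expR (2 * beta * y)).
Proof.
move=> y1; have y0 : 0 < 1 + y by lra.
by rewrite -expR_l// -[X in _ = (X < _)]mul1r ltr_pM2r// -[X in _ = (X < _)]expR0 ltr_expR.
Qed.

Let l_lt0P y : -1 < y < 1 ->
  (l y < 0) = ((1 - y) * expR (2 * beta * y) < 1 + y).
Proof.
move=> y1; have y0 : 0 < 1 + y by lra.
by rewrite -expR_l// -[X in _ = (_ < X)]mul1r ltr_pM2r// -[X in _ = (_ < X)]expR0 ltr_expR.
Qed.

(** Multiplying by exp(beta y) clears the fractions; for -1 < y < 1 the resulting equation says that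
    [l] vanishes at [y]. *)
Let tanh_fixP y :
  tanh (beta * y) = y <-> (1 - y) * expR (2 * beta * y) = 1 + y.
Proof.
have -> : 2 * beta * y = beta * y + beta * y by ring.
rewrite /tanh expRN expRD; set e := expR _.
have e0 : 0 < e by exact: expR_gt0.
have ee0 : 0 < e + e^-1 by rewrite addr_gt0// invr_gt0.
split => [h|h].
  have : e - e^-1 = y * (e + e^-1) by rewrite -[in RHS]h divfK// gt_eqF.
  move=> /(congr1 ( *%R e)); rewrite mulrBr mulrCA mulrDr mulfV ?gt_eqF//; nra.
apply: (mulIf (lt0r_neq0 ee0)); rewrite divfK ?gt_eqF//.
apply: (mulfI (lt0r_neq0 e0)).
rewrite mulrBr mulrCA mulrDr mulfV ?gt_eqF//; nra.
Qed.

Let exists_fix : 1 < beta -> exists2 y, 0 < y & tanh (beta * y) = y.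
Proof.
(* For 0 < c < a < 1 one has 1 - c^2 > 1 - a = 1/beta, so [dl c] is positive; hence l(a) > 0, while
   [g 1 = -2]. *)
move=> b1; pose a := 1 - beta^-1.
have bV : 0 < beta^-1 < 1 by rewrite invr_gt0 invf_lt1; lra.
have a0 : 0 < a by rewrite /a; lra.
have a1 : a < 1 by rewrite /a; lra.
have [c /andP[c0 ca] lc] := l_slope a0 a1.
have la : 0 < l a.
  rewrite lc mulr_gt0// /dl subr_gt0 ltr_pM2l// invf_plt ?posrE; [|nra|lra].
  by rewrite (_ : beta^-1 = 1 - a); [nra|rewrite /a; ring].
pose g y := (1 - y) * expR (2 * beta * y) - (1 + y).
have [||y] := @IVT R g a 1 0 (ltW a1).
- apply: continuous_subspaceT => x; apply: differentiable_continuous.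
  exact/derivable1_diffP.
- have : 0 < g a by rewrite /g subr_gt0 -l_gt0P// a1 andbT; lra.
  have : g 1 = -2 by rewrite /g; ring.
  by rewrite ge_min le_max => -> ga; apply/andP; split; apply/orP; [right|left]; lra.
rewrite in_itv /= => /andP[ay _] gy; exists y; first lra.
by apply/tanh_fixP/eqP; rewrite -subr_eq0; apply/eqP.
Qed.

Let m := magnetization beta.

Let magnetization_cases :
  (beta <= 1 /\ m = 0) \/ [/\ 1 < beta, 0 < m & tanh (beta * m) = m].
Proof.
rewrite /m /magnetization; case: (leP beta 1) => [|b1]; [by left|right].
by have [y y0 hy] := exists_fix b1; case: xgetP => [_ -> [? ?]|/(_ y)[]].
Qed.

Let fix_lt1 y : (1 - y) * expR (2 * beta * y) = 1 + y -> 0 < y -> y < 1.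
Proof. by move=> h y0; have := expR_gt0 (2 * beta * y); nra. Qed.

Lemma magnetization_itv : 0 <= m < 1.
Proof.
case: magnetization_cases => [[_ ->]|[_ m0 /tanh_fixP hm]].
  by rewrite lexx ltr01.
by rewrite ltW// (fix_lt1 hm).
Qed.

(** For beta > 1, [l] vanishes at m and l(y)/y is strictly decreasing, so [l] is positive before m.
    For beta <= 1, m = 0 and there is no such y. *)
Lemma drift_gt0 y : 0 < y < m -> 1 + y < (1 - y) * expR (2 * beta * y).
Proof.
case: magnetization_cases => [[_ ->]|[_ m0 /tanh_fixP hm]] /andP[y0 ym]; first lra.
have m1 := fix_lt1 hm m0.
have lm : l m = 0.
  apply/eqP; rewrite eq_le !leNgt l_gt0P ?l_lt0P ?hm ?ltxx//; apply/andP; split; lra.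
have := l_lt y0 ym m1; rewrite lm mulr0 pmulr_rgt0// l_gt0P//.
by apply/andP; split; lra.
Qed.

Lemma drift_lt0 y : m < y <= 1 -> (1 - y) * expR (2 * beta * y) < 1 + y.
Proof.
move=> /andP[my]; rewrite le_eqVlt => /predU1P[->|y1]; first by rewrite subrr mul0r; lra.
have y0 : 0 < y by have /andP[? _] := magnetization_itv; lra.
rewrite -l_lt0P; last by apply/andP; split; lra.
(* For beta <= 1 the derivative [dl] is negative on (0, 1), so [l] decreases from 0; for beta > 1,
   [l] vanishes at m and l(y)/y decreases. *)
case: magnetization_cases => [[b1 _]|[_ m0 /tanh_fixP hm]].
  have [c /andP[c0 cy] ->] := l_slope y0 y1.
  have : 1 < (1 - c ^+ 2)^-1 by rewrite invf_gt1; nra.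
  by rewrite pmulr_llt0// /dl; lra.
have lm : l m = 0.
  apply/eqP; rewrite eq_le !leNgt l_gt0P ?l_lt0P ?hm ?ltxx//; apply/andP; split; lra.
have := l_lt m0 my y1; rewrite lm mulr0; nra.
Qed.

End drift.

Lemma drift_continuous (R : realType) (beta : R) :
  continuous (fun y : R => (1 - y) * expR (2 * beta * y) - (1 + y)).
Proof.
by move=> x; apply: differentiable_continuous; exact/derivable1_diffP.
Qed.

(** The strict inequality becomes uniform by compactness of [a, b]. *)
Lemma drift_ge (R : realType) (beta a b : R) :
  0 < a -> b < magnetization beta ->
  exists2 d, 0 < d &
    forall y, a <= y <= b -> (1 + d) * (1 + y) <= (1 - y) * expR (2 * beta * y).
Proof.
move=> a0 bm; have [ab|ba] := leP a b; last first.
  by exists 1 => // y /andP[? ?]; lra.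
have [c] := EVT_min ab (continuous_subspaceT (@drift_continuous R beta)).
rewrite in_itv /= => /andP[ac cb] gmin.
pose g := (1 - c) * expR (2 * beta * c) - (1 + c).
have g0 : 0 < g by rewrite /g subr_gt0; apply: drift_gt0 => //; apply/andP; split; lra.
(* Half the minimum is enough because 1 + y <= 2. *)
exists (g / 2) => [|y /andP[ay yb]]; first by rewrite divr_gt0.
have /andP[_ m1] := magnetization_itv beta.
have := gmin y; rewrite in_itv /= ay yb => /(_ isT); rewrite -/g.
have : 0 <= g * (1 - y) by rewrite mulr_ge0; lra.
lra.
Qed.

Lemma drift_le (R : realType) (beta a : R) :
  magnetization beta < a ->
  exists2 d, 0 < d &
    forall y, a <= y <= 1 -> (1 - y) * expR (2 * beta * y) <= (1 - d) * (1 + y).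
Proof.
move=> ma; have [a1|a1] := leP a 1; last first.
  by exists 1 => // y /andP[? ?]; lra.
have [c] := EVT_max a1 (continuous_subspaceT (@drift_continuous R beta)).
rewrite in_itv /= => /andP[ac c1] gmax.
pose g := (1 - c) * expR (2 * beta * c) - (1 + c).
have g0 : g < 0 by rewrite /g subr_lt0; apply: drift_lt0 => //; apply/andP; split; lra.
exists (- g / 2) => [|y /andP[ay y1]]; first by rewrite divr_gt0// oppr_gt0.
have := gmax y; rewrite in_itv /= ay y1 => /(_ isT); rewrite -/g.
have : 0 <= - g * (1 - y) by rewrite mulr_ge0; lra.
lra.
Qed.

(** * Weights of the magnetization levels *)

Section levels.
Context (R : realType).

Lemma geometric_growth (c : R) (u : nat -> R) (J : nat) :
  0 <= c -> (forall i, (i < J)%N -> c * u i <= u i.+1) -> c ^+ J * u 0%N <= u J.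
Proof.
move=> c0; elim: J => [|J IH] h; first by rewrite mul1r.
rewrite exprS -mulrA; apply: le_trans (h J (ltnSn _)).
by rewrite ler_wpM2l// IH// => i iJ; apply: h; exact: ltnW.
Qed.

Lemma bernoulli_le (d : R) (n : nat) : 0 <= d -> 1 + n%:R * d <= (1 + d) ^+ n.
Proof.
move=> d0; elim: n => [|n IH]; first by rewrite mul0r addr0 expr0.
rewrite exprS -natr1; apply: (@le_trans _ _ ((1 + d) * (1 + n%:R * d))).
  by have := mulr_ge0 (mulr_ge0 (ler0n R n) d0) d0; nra.
by rewrite ler_wpM2l//; lra.
Qed.

(* Bernoulli's inequality is applied to each half of the 2J steps: the resulting
   quadratic gain beats the N + 1 levels to be summed. *)
Lemma growth_bound (d D n Z : R) (u : nat -> R) (J : nat) :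
  0 < d -> 0 <= D -> 0 <= n -> n <= 2 * (J%:R * D) -> 0 <= u 0%N ->
  (forall i, (i < J + J)%N -> (1 + d) * u i <= u i.+1) -> u (J + J)%N <= Z ->
  u 0%N * n ^+ 2 <= 4 * D ^+ 2 / d ^+ 2 * Z.
Proof.
move=> d0 D0 n0 nJ u0 h uZ.
have d10 : 0 <= 1 + d by lra.
have := geometric_growth d10 h; rewrite exprD => hJ.
have B := bernoulli_le J (ltW d0).
have nd : n * d <= 2 * D * (1 + d) ^+ J.
  apply: (@le_trans _ _ (2 * D * (1 + J%:R * d))).
    apply: (@le_trans _ _ (2 * (J%:R * D) * d)); first by rewrite ler_pM2r.
    by have := ler0n R J; nra.
  by rewrite ler_wpM2l ?mulr_ge0.
have nd2 : (n * d) ^+ 2 <= (2 * D * (1 + d) ^+ J) ^+ 2.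
  by rewrite ler_sqr ?nnegrE// ?mulr_ge0 ?exprn_ge0// ltW.
rewrite mulrAC ler_pdivlMr ?exprn_gt0//.
have -> : u 0%N * n ^+ 2 * d ^+ 2 = (n * d) ^+ 2 * u 0%N by ring.
apply: (@le_trans _ _ ((2 * D * (1 + d) ^+ J) ^+ 2 * u 0%N)); first by rewrite ler_wpM2r.
have -> : (2 * D * (1 + d) ^+ J) ^+ 2 * u 0%N =
  4 * D ^+ 2 * ((1 + d) ^+ J * (1 + d) ^+ J * u 0%N) by ring.
by rewrite ler_wpM2l ?mulr_ge0 ?exprn_ge0//; exact: le_trans uZ.
Qed.

Context (beta : R).
Hypothesis beta_ge0 : 0 <= beta.

(* Total weight of the configurations with k up spins, hence total spin 2k - N. *)
Definition level_weight (N k : nat) : R :=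
  'C(N, k)%:R * expR (beta / (2 * N%:R) * (2 * k%:R - N%:R) ^+ 2).

Lemma level_weight_ge0 N k : 0 <= level_weight N k.
Proof. by rewrite mulr_ge0 ?expR_ge0. Qed.

Lemma level_weightC N k : (k <= N)%N -> level_weight N (N - k) = level_weight N k.
Proof.
move=> kN; rewrite /level_weight bin_sub// natrB//; congr (_ * expR (_ * _)).
by ring.
Qed.

(* The mean magnetizations with k and k+1 up spins are midpoint -+ 1/N; at this
   point the ratio of consecutive weights has the exact form [level_weightS]. *)
Definition midpoint (N k : nat) : R := (2 * k%:R + 1 - N%:R) / N%:R.

Lemma level_weightS N k : (k < N)%N -> let y := midpoint N k in
  level_weight N k.+1 * (1 + y + N%:R^-1) =
  (1 - y + N%:R^-1) * expR (2 * beta * y) * level_weight N k.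
Proof.
move=> kN y; have n0 : N%:R != 0 :> R by rewrite pnatr_eq0; lia.
have e1 : 1 + y + N%:R^-1 = 2 * k.+1%:R / N%:R.
  by rewrite /y /midpoint -natr1; field.
have e2 : 1 - y + N%:R^-1 = 2 * (N - k)%:R / N%:R.
  by rewrite /y /midpoint natrB; [field|exact: ltnW].
have e3 : beta / (2 * N%:R) * (2 * k.+1%:R - N%:R) ^+ 2 =
    2 * beta * y + beta / (2 * N%:R) * (2 * k%:R - N%:R) ^+ 2.
  by rewrite /y /midpoint -natr1; field.
rewrite e1 e2 /level_weight e3 expRD.
have := congr1 (fun n => n%:R : R) (mul_bin_left N k); rewrite !natrM => e4.
transitivity (2 / N%:R * (k.+1%:R * 'C(N, k.+1)%:R) * expR (2 * beta * y) *
  expR (beta / (2 * N%:R) * (2 * k%:R - N%:R) ^+ 2)); first by ring.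
by rewrite e4; ring.
Qed.

(** The corrections 1/N in [level_weightS] do no harm here: for y >= 0 the hypothesis forces c <=
    exp(2 beta y), so the left side gains at most as much as the right. *)
Lemma level_weight_up N k (c : R) : (k < N)%N -> let y := midpoint N k in
  0 <= y -> 0 <= c -> c * (1 + y) <= (1 - y) * expR (2 * beta * y) ->
  c * level_weight N k <= level_weight N k.+1.
Proof.
move=> kN y y0 c0 hc.
have h0 : 0 < N%:R^-1 :> R by rewrite invr_gt0 ltr0n; lia.
set h := N%:R^-1 in h0.
have E0 := expR_gt0 (2 * beta * y).
have p0 : 0 < 1 + y + h by lra.
rewrite -(ler_pM2r p0) level_weightS// mulrAC ler_wpM2r ?level_weight_ge0//.
have cE : c <= expR (2 * beta * y) by nra.
rewrite -/y -/h; have := ler_wpM2r (ltW h0) cE; nra.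
Qed.

(** Here the correction exp(2 beta y)/N acts against the inequality. It costs at most d, half of the
    margin 2d, and (1 + d)(1 - d) <= 1 finishes. *)
Lemma level_weight_down N k (d : R) : (k < N)%N -> let y := midpoint N k in
  0 <= y <= 1 -> 0 <= d -> expR (2 * beta) / N%:R <= d ->
  (1 - y) * expR (2 * beta * y) <= (1 - 2 * d) * (1 + y) ->
  (1 + d) * level_weight N k.+1 <= level_weight N k.
Proof.
move=> kN y /andP[y0 y1] d0 hd hy.
have h0 : 0 < N%:R^-1 :> R by rewrite invr_gt0 ltr0n; lia.
have p0 : 0 < 1 + y + N%:R^-1 by lra.
have yE : expR (2 * beta * y) <= expR (2 * beta).
  by rewrite ler_expR; have : 0 <= beta * (1 - y) by [rewrite mulr_ge0 ?subr_ge0]; lra.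
have hE := ler_wpM2r (ltW h0) yE.
rewrite -(ler_pM2r p0) -mulrA level_weightS// mulrA [X in _ <= X]mulrC ler_wpM2r ?level_weight_ge0//.
rewrite -/y; move: h0 p0 hE hd; set h := N%:R^-1 => h0 p0 hE hd.
apply: (@le_trans _ _ ((1 + d) * ((1 - d) * (1 + y)))).
  rewrite ler_wpM2l//; first lra.
  by have := mulr_ge0 d0 y0; nra.
have : 0 <= d ^+ 2 * (1 + y) by rewrite mulr_ge0 ?sqr_ge0//; lra.
nra.
Qed.

(** With J = N %/ D at least 1, N < (J + 1) D <= 2 J D. *)
Lemma double_divn (N D : nat) : (2 * D <= N)%N -> (0 < D)%N ->
  exists2 J, (J * D <= N)%N & (N <= 2 * (J * D))%N.
Proof.
move=> ND D0; exists (N %/ D)%N; first exact: leq_trunc_div.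
rewrite mul2n -addnn (leq_trans (ltnW (ltn_ceil N D0)))// mulSn leq_add2r.
by rewrite leq_pmull// divn_gt0// (leq_trans _ ND)// leq_pmull.
Qed.

(** A far level is compared with one 2J or 3J steps closer to m, whose weight is at most the total.
    The resulting probability O(1/N^2) is small enough to be summed over N + 1 levels. *)
Lemma level_weight_small (eps : R) : 0 < eps ->
  let m := magnetization beta in
  exists2 C : R, 0 <= C & exists N0 : nat,
    forall N k : nat, (N0 <= N)%N -> (k <= N)%N ->
    eps <= `| `|(2 * k%:R - N%:R) / N%:R| - m| ->
    level_weight N k * N%:R ^+ 2 <= C * \sum_(i < N.+1) level_weight N i.
Proof.
move=> eps0 m.
have /andP[m0 m1] := magnetization_itv beta; rewrite -/m in m0 m1.
(* A step changes the mean magnetization by 2/N, and J <= N/D, so 3J steps move it by at most 6/D <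
   eps/2. *)
have [D Deps D0] : exists2 D : nat, 12 < eps * D%:R & (0 < D)%N.
  have b0 : 0 <= 12 / eps by rewrite divr_ge0// ltW.
  have hb := archi_boundP b0; exists (Num.bound (12 / eps)).
    by rewrite mulrC -ltr_pdivrMr.
  by rewrite -(ltr_nat R); exact: le_lt_trans hb.
have DR0 : 0 < D%:R :> R by rewrite ltr0n.
(* After J upward steps from a level with 2k >= N, the midpoint is at least 2J/N >= 1/D, where this
   uniform bound applies. *)
have [d1 d10 hd1] : exists2 d, 0 < d & forall y, D%:R^-1 <= y <= m - eps / 2 ->
    (1 + d) * (1 + y) <= (1 - y) * expR (2 * beta * y).
  by apply: drift_ge; rewrite ?invr_gt0// -/m; lra.
have [d2 d20 hd2] : exists2 d, 0 < d & forall y, m + eps / 2 <= y <= 1 ->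
    (1 - y) * expR (2 * beta * y) <= (1 - 2 * d) * (1 + y).
  have [|d d0 hd] := @drift_le R beta (m + eps / 2); rewrite -/m; first lra.
  by exists (d / 2) => [|y /hd]; [rewrite divr_gt0|rewrite mulrCA mulfV ?mulr1].
(* The first term allows [double_divn] to supply J; the second makes exp(2 beta)/N <= d2, as the
   downward step requires. *)
pose N0 := maxn (2 * D) (Num.bound (expR (2 * beta) / d2)).
pose c d := 4 * D%:R ^+ 2 / d ^+ 2 : R.
have c_gt0 d : 0 < d -> 0 < c d.
  by move=> d0; rewrite divr_gt0 ?mulr_gt0 ?exprn_gt0.
exists (c d1 + c d2); first by rewrite addr_ge0// ltW// c_gt0.
exists N0 => N k.
rewrite geq_max => /andP[N2D Nb].
(* Spin reversal exchanges the levels k and N - k, so the mean magnetization may be taken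
   nonnegative. *)
wlog Nk : k / (N <= 2 * k)%N => [hwlog kN hk|].
  have [Nk|Nk] := leqP N (2 * k); first exact: hwlog.
  have NNk : (N <= 2 * (N - k))%N by clear -Nk kN; lia.
  rewrite -level_weightC//; apply: hwlog; rewrite ?leq_subr//.
  rewrite natrB// (_ : 2 * _ - _ = - (2 * k%:R - N%:R)); last by ring.
  by rewrite mulNr normrN.
move=> kN hk.
have N0' : (0 < N)%N by clear -N2D D0; lia.
have n0 : 0 < N%:R :> R by rewrite ltr0n.
have kn : N%:R <= 2 * k%:R :> R by rewrite -natrM ler_nat.
have [J JDN NJD] : exists2 J : nat, J%:R * D%:R <= N%:R :> R &
    N%:R <= 2 * (J%:R * D%:R) :> R.
  have [J JDN NJD] := double_divn N2D D0.
  by exists J; rewrite -!natrM ler_nat.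
have J12 : 12 * J%:R <= eps * N%:R.
  have := ler_wpM2l (ltW eps0) JDN; have := ler0n R J; nra.
set Z := \sum_(i < N.+1) level_weight N i.
have qZ i : (i <= N)%N -> level_weight N i <= Z.
  move=> iN; have iN' : (i < N.+1)%N by [].
  rewrite /Z (bigD1 (Ordinal iN')) //= lerDl sumr_ge0// => j _.
  exact: level_weight_ge0.
have Z0 : 0 <= Z by apply: le_trans (qZ 0%N _); rewrite ?level_weight_ge0.
suff [d [dd hd]] : exists d, (d = d1 \/ d = d2) /\
    level_weight N k * N%:R ^+ 2 <= c d * Z.
  apply: le_trans hd _; rewrite ler_wpM2r//.
  by case: dd => ->; rewrite ?lerDl ?lerDr ltW// c_gt0.
rewrite [`|_ / _|]ger0_norm in hk; last by rewrite divr_ge0 ?ler0n// subr_ge0.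
have kx : (2 * k%:R - N%:R) = (2 * k%:R - N%:R) / N%:R * N%:R :> R.
  by rewrite divfK// gt_eqF.
move: hk kx; set x := _ / N%:R => hk kx.
have mid i : midpoint N i * N%:R = 2 * i%:R + 1 - N%:R by rewrite divfK// gt_eqF.
(* Either x <= m - eps, treated first by climbing, or x >= m + eps, treated last by descending. *)
move: hk; rewrite ler_normr => /orP[hk|hk]; last first.
  exists d1; split; first by left.
  have mid_le i : (i < 3 * J)%N -> midpoint N (k + i) <= m - eps / 2.
    move=> iJ; rewrite -(ler_pM2r n0) mid natrD.
    have : i%:R + 1 <= 3 * J%:R :> R by rewrite natr1 -natrM ler_nat.
    have : (x - (m - eps)) * N%:R <= 0 by apply: mulr_le0_ge0; [lra|exact: ltW].
    lra.
  have mid_ge0 i : 0 <= midpoint N (k + i).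
    by rewrite -(ler_pM2r n0) mid natrD mul0r; have := ler0n R i; lra.
  have kiN i : (i < 3 * J)%N -> (k + i < N)%N.
    move=> /mid_le; rewrite -(ler_pM2r n0) mid -(ltr_nat R) => h.
    have : (m - eps / 2 - 1) * N%:R <= 0 by apply: mulr_le0_ge0; [lra|exact: ltW].
    lra.
  (* The first J steps only leave a neighbourhood of 0, where the ratio tends
     to 1; the next 2J steps gain a uniform factor. *)
  have q1 : level_weight N k <= level_weight N (k + J).
    have := @geometric_growth 1 (fun i => level_weight N (k + i)) J ler01.
    rewrite expr1n mul1r addn0; apply=> i iJ; rewrite addnS.
    have iJ3 : (i < 3 * J)%N by clear -iJ; lia.
    apply: level_weight_up => //; first exact: kiN.
    rewrite mul1r; have [->|y0] := eqVneq (midpoint N (k + i)) 0.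
      by rewrite mulr0 expR0; lra.
    apply: ltW; apply: drift_gt0 => //; rewrite -/m lt0r y0 mid_ge0 /=.
    by have := mid_le _ iJ3; lra.
  apply: (@le_trans _ _ (level_weight N (k + J) * N%:R ^+ 2)).
    by rewrite ler_wpM2r ?exprn_ge0// ltW.
  have B := @growth_bound d1 D%:R N%:R Z (fun i => level_weight N (k + J + i)) J
    d10 (ltW DR0) (ltW n0) NJD (level_weight_ge0 _ _).
  rewrite addn0 in B; apply: B.
    move=> i iJ; rewrite addnS; apply: level_weight_up => //; rewrite -?addnA ?kiN ?mid_ge0//.
    - by clear -iJ; lia.
    - lra.
    - apply: hd1; rewrite mid_le ?andbT; last by clear -iJ; lia.
      rewrite -(ler_pM2r n0) mid natrD natrD mulrC ler_pdivrMr//.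
      by have := ler0n R i; have := ler0n R J; nra.
  apply: qZ; have [J0|J0] := posnP J; first by rewrite J0 !addn0.
  by have := @kiN (J + J + J).-1; clear -J0; lia.
exists d2; split; first by right.
(* The descent from level k - i to its predecessor is governed by the midpoint of the lower level,
   hence the [.-1]. All 2J midpoints stay at or above m + eps/2. *)
have ge_mid i : (i < J + J)%N -> m + eps / 2 <= midpoint N (k - i).-1 /\ (i < k)%N.
  move=> iJ.
  have iJ' : i%:R + 1 <= 2 * J%:R :> R by rewrite natr1 -natrM ler_nat; clear -iJ; lia.
  have h : 0 <= (x - (m + eps)) * N%:R by apply: mulr_ge0; [lra|exact: ltW].
  have mn : 0 <= m * N%:R by rewrite mulr_ge0// ltW.
  have ik : (i < k)%N by rewrite -(ltr_nat R); lra.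
  split => //; rewrite -(ler_pM2r n0) mid.
  have -> : (k - i).-1%:R = k%:R - i%:R - 1 :> R.
    by rewrite -subn1 !natrB//; clear -ik; lia.
  by have := ler0n R J; lra.
have B := @growth_bound d2 D%:R N%:R Z (fun i => level_weight N (k - i)) J
  d20 (ltW DR0) (ltW n0) NJD (level_weight_ge0 _ _).
rewrite subn0 in B; apply: B; last exact/qZ/(leq_trans (leq_subr _ _)).
move=> i /ge_mid[yi ik]; rewrite subnS.
have ki : (k - i = (k - i).-1.+1)%N by clear -ik; lia.
have y1 : midpoint N (k - i).-1 <= 1.
  rewrite -(ler_pM2r n0) mid mul1r.
  have : (k - i).-1.+1%:R <= N%:R :> R by rewrite ler_nat -ki; exact: leq_trans (leq_subr _ _) kN.
  by rewrite -natr1; lra.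
rewrite [in X in X <= _]ki; apply: (@level_weight_down _ _ d2).
- by rewrite -ki (leq_trans (leq_subr _ _)).
- by rewrite y1 andbT; lra.
- by lra.
- rewrite ler_pdivrMr// [d2 * _]mulrC -ler_pdivrMr//.
  have b0 : 0 <= expR (2 * beta) / d2 by rewrite divr_ge0 ?expR_ge0// ltW.
  by apply: ltW; apply: lt_le_trans (archi_boundP b0) _; rewrite ler_nat.
- by rewrite hd2 ?yi.
Qed.

End levels.

(** * Expectations, symmetries and spin correlations *)

Section mean.
Context (R : realType) (beta : R) (N : nat).
Implicit Types (g h : config N -> R) (x : config N) (A : {set 'I_N}).

Definition cw_mean g : R := \sum_x cw_pmf beta x * g x.

Lemma cw_mean_cst (c : R) : cw_mean (fun=> c) = c.
Proof.
rewrite /cw_mean -mulr_suml -mulr_sumr -/(cw_Z _ _) mulVf ?mul1r//.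
by rewrite gt_eqF ?cw_Z_gt0.
Qed.

Lemma ler_cw_mean g h : (forall x, g x <= h x) -> cw_mean g <= cw_mean h.
Proof. by move=> gh; apply: ler_sum => x _; rewrite ler_wpM2l ?cw_pmf_ge0. Qed.

Lemma cw_meanD g h : cw_mean (fun x => g x + h x) = cw_mean g + cw_mean h.
Proof. by rewrite -big_split; apply: eq_bigr => x _ /=; rewrite mulrDr. Qed.

Lemma cw_meanZ (c : R) g : cw_mean (fun x => c * g x) = c * cw_mean g.
Proof. by rewrite [RHS]mulr_sumr; apply: eq_bigr => x _ /=; rewrite mulrCA. Qed.

Lemma cw_mean_sum (I : finType) (g : I -> config N -> R) :
  cw_mean (fun x => \sum_i g i x) = \sum_i cw_mean (g i).
Proof. by rewrite exchange_big; apply: eq_bigr => x _; rewrite mulr_sumr. Qed.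

Lemma ler_norm_cw_mean g : `|cw_mean g| <= cw_mean (fun x => `|g x|).
Proof.
apply: le_trans (ler_norm_sum _ _ _) _; apply: ler_sum => x _.
by rewrite normrM ger0_norm ?cw_pmf_ge0.
Qed.

(** The weight depends on a configuration only through the squared total spin. This serves both the
    global flip and the permutations of the sites. *)
Lemma cw_mean_reindex (f : config N -> config N) g : bijective f ->
  (forall x, (\sum_j spin R j (f x)) ^+ 2 = (\sum_j spin R j x) ^+ 2) ->
  cw_mean (g \o f) = cw_mean g.
Proof.
move=> bf hf; rewrite [RHS](reindex f) /=; last exact: onW_bij.
by apply: eq_bigr => x _; rewrite /cw_pmf /cw_weight hf.
Qed.

Definition spin_flip x : config N := [ffun i => ~~ x i].

Lemma spin_flipK : involutive spin_flip.
Proof. by move=> x; apply/ffunP => i; rewrite !ffunE negbK. Qed.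

Lemma spin_spin_flip i x : spin R i (spin_flip x) = - spin R i x.
Proof. by rewrite /spin ffunE; case: (x i); rewrite ?opprK. Qed.

Lemma spin_average_flip A x : spin_average R A (spin_flip x) = - spin_average R A x.
Proof.
by rewrite /spin_average -mulrN -sumrN; under eq_bigr do rewrite spin_spin_flip.
Qed.

Lemma cw_mean_flip g : cw_mean (g \o spin_flip) = cw_mean g.
Proof.
apply: cw_mean_reindex; first exact: inv_bij spin_flipK.
by move=> x; under eq_bigr do rewrite spin_spin_flip; rewrite sumrN sqrrN.
Qed.

Definition spin_permute (s : {perm 'I_N}) x : config N := [ffun i => x (s i)].

Lemma cw_mean_permute s g : cw_mean (g \o spin_permute s) = cw_mean g.
Proof.
apply: cw_mean_reindex => [|x].
  exists (spin_permute s^-1) => x; apply/ffunP => i; rewrite !ffunE.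
    by rewrite permKV.
  by rewrite permK.
congr (_ ^+ 2); rewrite [RHS](reindex_perm s); apply: eq_bigr => i _.
by rewrite /spin ffunE.
Qed.

Definition spin_corr (i j : 'I_N) : R := cw_mean (fun x => spin R i x * spin R j x).

Lemma spin_corr_permute (s : {perm 'I_N}) i j : spin_corr (s i) (s j) = spin_corr i j.
Proof.
rewrite -[RHS](cw_mean_permute s) /spin_corr /=.
by apply: eq_bigr => x _; rewrite /= /spin /spin_permute !ffunE.
Qed.

Lemma spin_corr_diag i : spin_corr i i = 1.
Proof.
rewrite -[RHS](cw_mean_cst 1); apply: eq_bigr => x _; congr (_ * _).
by rewrite /spin; case: (x i); rewrite ?mulrNN mulr1.
Qed.

Lemma spin_corr_geN1 i j : -1 <= spin_corr i j.
Proof.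
rewrite -(cw_mean_cst (-1)); apply: ler_cw_mean => x.
by rewrite /spin; case: (x i); case: (x j); lra.
Qed.

Lemma spin_corr_offdiag :
  exists2 c, -1 <= c & forall i j, i != j -> spin_corr i j = c.
Proof.
case: (pickP (fun ij : 'I_N * 'I_N => ij.1 != ij.2)) => [[k l] /= kl|no]; last first.
  (* With at most one spin there is no pair of distinct sites, and 0 is an arbitrary choice. *)
  by exists 0 => [|i j]; [lra|rewrite (no (i, j))].
exists (spin_corr k l) => [|i j ij]; first exact: spin_corr_geN1.
(* The first transposition sends i to k; the second sends the image of j to l and fixes k. *)
pose s := (tperm i k * tperm (tperm i k j) l)%g.
have sj : s j = l by rewrite permM tpermL.
have si : s i = k.
  rewrite permM tpermL tpermD//; last by rewrite eq_sym.
  by rewrite -[X in _ != X](tpermL i k) (inj_eq perm_inj) eq_sym.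
by rewrite -si -sj spin_corr_permute.
Qed.

(** The difference is a linear form in the spins whose coefficients [v] sum to zero, so the common
    correlation c enters only through the factor 1 - c <= 2. *)
Lemma spin_average_variance A : A != finset.set0 ->
  cw_mean (fun x => (spin_average R A x - spin_average R [set: 'I_N]%SET x) ^+ 2)
    <= 2 / #|A|%:R.
Proof.
rewrite -card_gt0 => A0.
have [c c1 hc] := spin_corr_offdiag.
have n0 : 0 < N%:R :> R by rewrite ltr0n (leq_trans A0)// -[X in (_ <= X)%N]card_ord max_card.
have a0 : 0 < #|A|%:R :> R by rewrite ltr0n.
pose v i : R := (i \in A)%:R / #|A|%:R - N%:R^-1.
have sumA : \sum_i (i \in A)%:R = #|A|%:R :> R.
  by rewrite -sumr_const [RHS]big_mkcond; apply: eq_bigr => i _; case: (i \in A).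
have sumv : \sum_i v i = 0.
  rewrite big_split /= -mulr_suml sumA sumr_const card_ord mulfV ?gt_eqF//.
  by rewrite -[_ *+ N]mulr_natr mulNr mulVf ?gt_eqF// subrr.
have sumv2 : \sum_i v i ^+ 2 = #|A|%:R^-1 - N%:R^-1.
  transitivity (\sum_i ((i \in A)%:R * (#|A|%:R^-1 * (#|A|%:R^-1 - N%:R^-1)) -
      N%:R^-1 * v i)).
    by apply: eq_bigr => i _; rewrite /v; case: (i \in A) => /=; ring.
  rewrite big_split /= sumrN -mulr_suml -mulr_sumr sumv sumA mulr0 subr0.
  by rewrite mulrA mulfV ?mul1r ?gt_eqF.
have diffE x : spin_average R A x - spin_average R [set: 'I_N]%SET x =
    \sum_i v i * spin R i x.
  rewrite /spin_average cardsT card_ord mulr_sumr big_mkcond mulr_sumr.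
  rewrite [X in _ - X](eq_bigl xpredT); last by move=> i; rewrite inE.
  rewrite -sumrB; apply: eq_bigr => i _; rewrite /v mulrBl; case: (i \in A).
    by rewrite mul1r.
  by rewrite !mul0r.
have -> : cw_mean (fun x => (spin_average R A x - spin_average R [set: 'I_N]%SET x) ^+ 2)
    = \sum_i \sum_j v i * v j * spin_corr i j.
  transitivity (cw_mean (fun x => \sum_i \sum_j (v i * v j) * (spin R i x * spin R j x))).
    apply: eq_bigr => x _; rewrite diffE expr2 mulr_suml; congr (_ * _).
    by apply: eq_bigr => i _; rewrite mulr_sumr; apply: eq_bigr => j _; ring.
  rewrite cw_mean_sum; apply: eq_bigr => i _; rewrite cw_mean_sum.
  by apply: eq_bigr => j _; rewrite cw_meanZ.
have -> : \sum_i \sum_j v i * v j * spin_corr i j =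
    (1 - c) * (#|A|%:R^-1 - N%:R^-1).
  rewrite -sumv2 mulr_sumr; apply: eq_bigr => i _.
  (* Adding c v_i^2 to the off-diagonal terms completes a row whose sum vanishes; 1 - c is left on
     the diagonal. *)
  transitivity (\sum_j v i * c * v j + (1 - c) * v i ^+ 2).
    rewrite (bigD1 i) //= [in RHS](bigD1 i) //= spin_corr_diag.
    rewrite [X in _ + X = _](_ : _ = \sum_(j | j != i) v i * c * v j); first by ring.
    by apply: eq_bigr => j ji; rewrite hc 1?eq_sym//; ring.
  by rewrite -mulr_sumr sumv mulr0 add0r.
have nV : 0 < N%:R^-1 :> R by rewrite invr_gt0.
have aV : 0 < #|A|%:R^-1 :> R by rewrite invr_gt0.
have aN : N%:R^-1 <= #|A|%:R^-1 :> R.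
  by rewrite lef_pV2 ?posrE// ler_nat -[X in (_ <= X)%N]card_ord max_card.
nra.
Qed.

End mean.

(** * The law of the mean magnetization and its concentration *)

Section magnetization_levels.
Context (R : realType) (beta : R) (N : nat).

Lemma sum_spin (x : config N) :
  \sum_j spin R j x = 2 * #|[set i | x i]%SET|%:R - N%:R.
Proof.
have -> : 2 * #|[set i | x i]%SET|%:R - N%:R = \sum_j (2 * (x j)%:R - 1) :> R.
  rewrite sumrB sumr_const card_ord -mulr_sumr; congr (_ * _ - _).
  rewrite -sumr_const big_mkcond; apply: eq_bigr => i _.
  by rewrite inE; case: (x i).
by apply: eq_bigr => i _; rewrite /spin; case: (x i) => /=; ring.
Qed.

Lemma spin_averageT (x : config N) :
  spin_average R [set: 'I_N]%SET x = (\sum_j spin R j x) / N%:R.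
Proof.
rewrite /spin_average cardsT card_ord mulrC; congr (_ / _).
by apply: eq_bigl => i; rewrite inE.
Qed.

(** A configuration is identified with its set of up spins; there are C(N, k) sets of size k, all of
    the same weight. *)
Lemma sum_cw_weight_levels (F : nat -> R) :
  \sum_(x : config N) cw_weight beta x * F #|[set i | x i]%SET| =
  \sum_(k < N.+1) level_weight beta N k * F k.
Proof.
pose f (A : {set 'I_N}) : config N := [ffun i => i \in A].
have fK A : [set i | f A i]%SET = A by apply/setP => i; rewrite inE ffunE.
have Kf (x : config N) : f [set i | x i]%SET = x.
  by apply/ffunP => i; rewrite ffunE inE.
rewrite (reindex f) /=; last by exists (fun x : config N => [set i | x i]%SET) => ? _.
have cardN (A : {set 'I_N}) : (#|A| < N.+1)%N.
  by rewrite ltnS -[X in (_ <= X)%N]card_ord max_card.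
rewrite (partition_big (fun A : {set 'I_N} => Ordinal (cardN A)) xpredT)//=.
apply: eq_bigr => k _.
pose w : R := expR (beta / (2 * N%:R) * (2 * k%:R - N%:R) ^+ 2).
rewrite (eq_bigr (fun=> w * F k)) => [|A /eqP Ak]; last first.
  by rewrite /w -Ak /cw_weight sum_spin fK.
rewrite sumr_const /level_weight -/w -mulrA [RHS]mulr_natl; congr (_ *+ _).
have := card_draws 'I_N k; rewrite card_ord => <-; by apply: eq_card => A; rewrite !inE.
Qed.

Lemma cw_mean_levels (F : nat -> R) :
  cw_mean beta (fun x : config N => F #|[set i | x i]%SET|) =
  (\sum_(k < N.+1) level_weight beta N k)^-1 *
  \sum_(k < N.+1) level_weight beta N k * F k.
Proof.
have -> : \sum_(k < N.+1) level_weight beta N k = cw_Z beta N.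
  have := sum_cw_weight_levels (fun=> 1).
  by under eq_bigr do rewrite mulr1; under [RHS]eq_bigr do rewrite mulr1.
rewrite -sum_cw_weight_levels mulr_sumr.
by apply: eq_bigr => x _; rewrite /cw_pmf mulrA.
Qed.

End magnetization_levels.

(** The mean of the indicator is the probability of a deviation. At most N + 1 bad levels, each of
    probability at most C/N^2, give (N + 1) C/N^2 <= 2C/N. *)
Lemma magnetization_concentration (R : realType) (beta eps : R) :
  0 <= beta -> 0 < eps ->
  exists (C : R) (N0 : nat), forall N : nat, (N0 <= N)%N ->
    cw_mean beta (fun x : config N =>
      (eps <= `| `|spin_average R [set: 'I_N]%SET x| - magnetization beta|)%R%:R)
    <= C / N%:R.
Proof.
move=> beta0 eps0.
have [C C0 [N0 small]] := level_weight_small beta0 eps0.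
exists (2 * C), N0.+1 => N N0N.
have n0 : 0 < N%:R :> R by rewrite ltr0n (leq_trans _ N0N).
pose bad k : bool := eps <= `| `|(2 * k%:R - N%:R) / N%:R| - magnetization beta|.
have -> : cw_mean beta (fun x : config N =>
      (eps <= `| `|spin_average R [set: 'I_N]%SET x| - magnetization beta|)%R%:R) =
    cw_mean beta (fun x : config N => (bad #|[set i | x i]%SET|)%:R).
  by apply: eq_bigr => x _; rewrite /bad -sum_spin spin_averageT.
rewrite (@cw_mean_levels R beta N (fun k => (bad k)%:R)).
set Z := \sum_(_ < _) _.
have Z0 : 0 < Z.
  rewrite /Z big_ord_recl /= ltr_pwDl ?sumr_ge0// => [|i _].
    by rewrite /level_weight bin0 mul1r expR_gt0.
  exact: level_weight_ge0.
rewrite mulrC ler_pdivrMr//.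
apply: (@le_trans _ _ (\sum_(k < N.+1) C * Z / N%:R ^+ 2)).
  apply: ler_sum => k _; have [hk|hk] := boolP (bad k).
    rewrite mulr1 ler_pdivlMr ?exprn_gt0//.
    by apply: small hk; [exact: ltnW|rewrite -ltnS].
  by rewrite mulr0 !mulr_ge0 ?invr_ge0 ?exprn_ge0// ltW.
rewrite sumr_const card_ord -[_ *+ N.+1]mulr_natr -[N.+1%:R]natr1.
have -> : C * Z / N%:R ^+ 2 * (N%:R + 1) = C * Z / N%:R * ((N%:R + 1) / N%:R).
  by field; rewrite gt_eqF.
have -> : 2 * C / N%:R * Z = C * Z / N%:R * 2 by ring.
apply: ler_wpM2l; first by rewrite !mulr_ge0 ?invr_ge0// ltW.
rewrite ler_pdivrMr//; have : 1 <= N%:R :> R by rewrite ler1n (leq_trans _ N0N).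
lra.
Qed.

(** * Comparison with the limit law and convergence in distribution *)

(** If both averages are within eta/2 of the overall mean M, and |M| within eta/2 of m, the vector
    is close to (m, m) or (- m, - m). Elsewhere only the bound K is used, on an event controlled by
    second moments and the last term. *)
Lemma cw_mean_spin_averages_close (R : realType) (beta : R) (N : nat)
    (A B : {set 'I_N}) (f : R * R -> R) (K eta e m : R) :
  A != finset.set0 -> B != finset.set0 -> 0 < eta -> 0 <= e ->
  (forall z, `|f z| <= K) ->
  (forall u v, `|u - m| < eta -> `|v - m| < eta -> `|f (u, v) - f (m, m)| <= e) ->
  (forall u v, `|u + m| < eta -> `|v + m| < eta ->
    `|f (u, v) - f (- m, - m)| <= e) ->
  `|cw_mean beta (fun x => f (spin_averages R A B x)) -
    (f (- m, - m) + f (m, m)) / 2| <=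
  e + 2 * K * (4 / eta ^+ 2 * (2 / #|A|%:R + 2 / #|B|%:R) +
    cw_mean beta (fun x : config N =>
      (eta / 2 <= `| `|spin_average R [set: 'I_N]%SET x| - m|)%R%:R)).
Proof.
move=> A0 B0 eta0 e0 fK fm fNm.
set c := (f (- m, - m) + f (m, m)) / 2.
have K0 : 0 <= K by apply: le_trans (fK (0, 0)).
(* Averaging over the global flip keeps the expectation and makes [h] close to the limit value
   whatever the sign of M. *)
pose h (x : config N) := (f (spin_averages R A B x) +
  f (spin_averages R A B (spin_flip x))) / 2.
have -> : cw_mean beta (fun x => f (spin_averages R A B x)) = cw_mean beta h.
  have -> : cw_mean beta h = cw_mean beta (fun x => 2^-1 * (f (spin_averages R A B x) +
      f (spin_averages R A B (spin_flip x)))).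
    by apply: eq_bigr => x _; rewrite [2^-1 * _]mulrC.
  rewrite cw_meanZ cw_meanD.
  rewrite -[X in _ + X]/(cw_mean beta ((fun x => f (spin_averages R A B x)) \o
    @spin_flip N)) cw_mean_flip; lra.
have -> : cw_mean beta h - c = cw_mean beta (fun x => h x + - c).
  by rewrite cw_meanD cw_mean_cst.
apply: le_trans (ler_norm_cw_mean _ _) _.
pose avg D := spin_average R (N := N) D.
pose dev D (x : config N) := (avg D x - avg [set: 'I_N]%SET x) ^+ 2.
pose bad (x : config N) := eta / 2 <= `| `|avg [set: 'I_N]%SET x| - m|.
have q0 : 0 < 4 / eta ^+ 2 by rewrite divr_gt0// exprn_gt0.
apply: (@le_trans _ _ (cw_mean beta (fun x => e + 2 * K *
    (4 / eta ^+ 2 * (dev A x + dev B x) + (bad x)%:R)))); last first.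
  rewrite cw_meanD cw_mean_cst lerD2l cw_meanZ ler_wpM2l ?mulr_ge0//.
  rewrite cw_meanD lerD2r cw_meanZ ler_pM2l// cw_meanD.
  by apply: lerD; exact: spin_average_variance.
apply: ler_cw_mean => x.
have dev0 D : 0 <= 4 / eta ^+ 2 * dev D x by rewrite mulr_ge0 ?sqr_ge0// ltW.
have bad0 : 0 <= (bad x)%:R :> R by rewrite ler0n.
have hK : `|h x - c| <= 2 * K.
  have := fK (spin_averages R A B x); have := fK (spin_averages R A B (spin_flip x)).
  have := fK (m, m); have := fK (- m, - m); rewrite /h /c !ler_norml.
  by do 4 move=> /andP[? ?]; apply/andP; split; lra.
(* Pointwise form of Chebyshev's inequality. *)
have far D : eta / 2 <= `|avg D x - avg [set: 'I_N]%SET x| -> 1 <= 4 / eta ^+ 2 * dev D x.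
  move=> hD; have : (eta / 2) ^+ 2 <= dev D x.
    by rewrite /dev -[X in _ <= X]real_normK ?num_real// ler_sqr// nnegrE ltW// divr_gt0.
  move=> /(ler_wpM2l (ltW q0)); suff -> : 4 / eta ^+ 2 * (eta / 2) ^+ 2 = 1 by [].
  by field; rewrite gt_eqF.
(* On each of the three bad events the factor of 2K is at least 1, so the trivial bound 2K
   suffices. *)
have large t : 1 <= t -> 2 * K <= e + 2 * K * t.
  by move=> t1; have : 0 <= K * (t - 1) by [rewrite mulr_ge0 ?subr_ge0]; lra.
have [hA|hA] := leP (eta / 2) `|avg A x - avg [set: 'I_N]%SET x|.
  apply: le_trans hK _; apply: large.
  by have := far _ hA; have := dev0 B; lra.
have [hB|hB] := leP (eta / 2) `|avg B x - avg [set: 'I_N]%SET x|.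
  apply: le_trans hK _; apply: large.
  by have := far _ hB; have := dev0 A; lra.
have [hM|hM] := boolP (bad x).
  apply: le_trans hK _; apply: large => /=.
  by have := dev0 A; have := dev0 B; lra.
rewrite /bad -ltNge in hM.
apply: (@le_trans _ _ e); last first.
  by rewrite lerDl !mulr_ge0// addr_ge0// mulrDr addr_ge0.
rewrite /h /c /spin_averages !spin_average_flip -!/(avg _ _).
move: hA hB hM; move: (avg A x) (avg B x) (avg [set: 'I_N]%SET x) => a b M.
rewrite !ltr_norml => /andP[a1 a2] /andP[b1 b2].
(* For M < 0 the vector is near (- m, - m) and its flip near (m, m); for M >= 0 the roles are
   exchanged. *)
have [M0|M0] := leP 0 M; last first.
  rewrite (ltr0_norm M0) => /andP[M1 M2].
  have := fm (- a) (- b); have := fNm a b.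
  rewrite !ltr_norml !ler_norml => F1 F2.
  have /andP[? ?] : - e <= f (a, b) - f (- m, - m) <= e.
    by apply: F1; apply/andP; split; lra.
  have /andP[? ?] : - e <= f (- a, - b) - f (m, m) <= e.
    by apply: F2; apply/andP; split; lra.
  by apply/andP; split; lra.
rewrite (ger0_norm M0) => /andP[M1 M2].
have := fm a b; have := fNm (- a) (- b).
rewrite !ltr_norml !ler_norml => F1 F2.
have /andP[? ?] : - e <= f (- a, - b) - f (- m, - m) <= e.
  by apply: F1; apply/andP; split; lra.
have /andP[? ?] : - e <= f (a, b) - f (m, m) <= e.
  by apply: F2; apply/andP; split; lra.
by apply/andP; split; lra.
Qed.

Lemma continuous_prod_near (R : realType) (f : R * R -> R) (m e : R) :
  continuous f -> 0 < e -> exists2 d, 0 < d &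
    forall u v, `|u - m| < d -> `|v - m| < d -> `|f (u, v) - f (m, m)| <= e.
Proof.
move=> cf e0; have /cvgrPdist_le/(_ _ e0) := cf (m, m).
move=> /nbhs_ballP[d /= d0 hd]; exists d => // u v um vm.
by rewrite distrC; apply: hd; split; rewrite /ball /= distrC.
Qed.

Lemma near_le_div (R : realType) (n : nat -> nat) (C e : R) :
  0 < e -> n N @[N --> \oo] --> \oo ->
  \forall N \near \oo, C / (n N)%:R <= e.
Proof.
move=> e0 /cvgnyPge n_oo; near=> N.
have nN : (maxn 1 (Num.bound (`|C| / e)) <= n N)%N by near: N; exact: n_oo.
move: nN; rewrite geq_max => /andP[n1 nb].
have n0 : 0 < (n N)%:R :> R by rewrite ltr0n.
rewrite ler_pdivrMr// [e * _]mulrC -ler_pdivrMr//.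
apply: (@le_trans _ _ (`|C| / e)); first by rewrite ler_pM2r ?invr_gt0// ler_norm.
have Ce : 0 <= `|C| / e by rewrite divr_ge0// ltW.
by rewrite (le_trans (ltW (archi_boundP Ce)))// ler_nat.
Unshelve. all: by end_near. Qed.

Theorem theorem1 (R : realType) (beta : R) (beta_ge0 : 0 <= beta)
  (N1 N2 : nat -> nat) (A B : forall N : nat, {set 'I_N})
  (sizes : forall N : nat, (2 <= N)%N ->
    [/\ (0 < N1 N)%N, (0 < N2 N)%N & (N1 N + N2 N <= N)%N])
  (groups : forall N : nat, (2 <= N)%N ->
    [/\ #|A N| = N1 N, #|B N| = N2 N & A N :&: B N = finset.set0])
  (N1_infty : N1 N @[N --> \oo] --> \oo)
  (N2_infty : N2 N @[N --> \oo] --> \oo) :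
  let m : R := magnetization beta in
  cvg_in_distribution
    (fun N : nat => spin_averages R (A N) (B N)
       : {RV (curie_weiss beta N) >-> (R * R)%type})
    (half_dirac2 (- m, - m) (m, m)).
Proof.
move=> m f cf [K fK].
have mf := continuous_measurable_prod cf.
have K0 : 0 <= K by apply: le_trans (fK (0, 0)).
rewrite integral_half_dirac2//.
have intE N : (\int[distribution (curie_weiss beta N)
      (spin_averages R (A N) (B N) : {RV (curie_weiss beta N) >-> (R * R)%type})]_z (f z)%:E)%E =
    (cw_mean beta (fun x => f (spin_averages R (A N) (B N) x)))%:E.
  rewrite integral_distribution; first exact: integral_curie_weiss.
    exact/measurable_EFinP.
  apply: measurable_bounded_integrable => //.
    by apply: le_lt_trans (probability_le1 _ _) _ => //; rewrite ltry.
  by exists K; split=> [|M KM x _ /=]; [exact: num_real|exact: le_trans (ltW KM)].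
under eq_fun do rewrite intE.
apply: cvg_EFin; first exact: nearW.
apply/cvgrPdist_le => e e0.
(* Half of e pays for the continuity of [f] at the two limit points; the two variance terms and the
   concentration term get e/6 each. *)
have e2 : 0 < e / 2 by rewrite divr_gt0.
have [d1 d10 hd1] := continuous_prod_near m cf e2.
have [d2 d20 hd2] := continuous_prod_near (- m) cf e2.
pose d := Num.min d1 d2.
have d0 : 0 < d by rewrite lt_min d10.
have [C [N0 hC]] := magnetization_concentration beta_ge0 (divr_gt0 d0 (ltr0n R 2)).
have e6 : 0 < e / 6 by rewrite divr_gt0.
near=> N.
(* Two disjoint nonempty groups need at least two spins. *)
have N2N : (2 <= N)%N by near: N; exact: nbhs_infty_ge.
have N0N : (N0 <= N)%N by near: N; exact: nbhs_infty_ge.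
have [n1 n2 _] := sizes _ N2N; have [a1 b1 _] := groups _ N2N.
rewrite distrC.
apply: le_trans (@cw_mean_spin_averages_close R beta N (A N) (B N) f K d (e / 2) m
  _ _ d0 (ltW e2) fK _ _) _; rewrite -?card_gt0 ?a1 ?b1//.
- by move=> u v um vm; apply: hd1; [move: um|move: vm]; rewrite lt_min => /andP[].
- move=> u v um vm; apply: hd2; rewrite opprK.
    by move: um; rewrite lt_min => /andP[].
  by move: vm; rewrite lt_min => /andP[].
have h1 : 2 * K * (4 / d ^+ 2) * 2 / (N1 N)%:R <= e / 6.
  by near: N; exact: near_le_div.
have h2 : 2 * K * (4 / d ^+ 2) * 2 / (N2 N)%:R <= e / 6.
  by near: N; exact: near_le_div.
have h3 : 2 * K * C / N%:R <= e / 6.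
  by near: N; apply: near_le_div => //; exact: cvg_id.
have h4 := ler_wpM2l (mulr_ge0 (ler0n R 2) K0) (hC N N0N).
lra.
Unshelve. all: by end_near. Qed.
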